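(* Let $q$ be a prime power and let $n,d$ be integers with $d$ even and $2\le d\le n$. Then $$\chi_d(n,q)\ \ge\ \max\{q,\lfloor 2n/d\rfloor\}.$$
   Context: Let $V_n=\mathbb{F}_q^n$ be the set of all length-$n$ vectors over the finite field $\mathbb{F}_q$. The Hamming distance $d_H(\mathbf{x},\mathbf{y})$ between $\mathbf{x},\mathbf{y}\in V_n$ is the number of coordinates in which they differ. A coloring $\Gamma:V_n\to\{1,\dots,L\}$ is called an exactly $d$-distance coloring if $\Gamma(\mathbf{x})\neq\Gamma(\mathbf{y})$ for all $\mathbf{x},\mathbf{y}\in V_n$ with $d_H(\mathbf{x},\mathbf{y})= d$. $\chi_d(n,q)$ denotes the minimum number $L$ of colors for which an exactly $d$-distance coloring of $V_n$ exists. *)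

(* Defs.v *)
From mathcomp Require Import all_boot all_order all_algebra.

Set Implicit Arguments.
Unset Strict Implicit.
Unset Printing Implicit Defensive.

Local Open Scope ring_scope.

Definition hamming_dist (F : finFieldType) (n : nat) (x y : 'rV[F]_n) : nat :=
  #|[set i : 'I_n | x ord0 i != y ord0 i]|.

(* The colors {1, ..., L} are represented by 'I_L = {0, ..., L - 1}. *)
Definition exact_dist_coloring (F : finFieldType) (n d L : nat)
    (G : {ffun 'rV[F]_n -> 'I_L}) : bool :=
  [forall x, forall y, (hamming_dist x y == d) ==> (G x != G y)].

Definition exact_dist_colorable (F : finFieldType) (n d L : nat) : bool :=
  [exists G : {ffun 'rV[F]_n -> 'I_L}, exact_dist_coloring d G].

(* Giving all vectors distinct colors works as soon as d > 0; for d = 0 there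
   is no coloring at all. *)
Lemma exact_dist_colorable_ex (F : finFieldType) (n d : nat) :
  (0 < d)%N -> exists L, exact_dist_colorable F n d L.
Proof.
move=> d_gt0; exists #|'rV[F]_n|; apply/existsP.
exists [ffun x => enum_rank x]; apply/forallP=> x; apply/forallP=> y.
apply/implyP=> /eqP dxy; rewrite !ffunE (inj_eq enum_rank_inj).
apply: contraTneq d_gt0 => eq_xy.
rewrite -dxy eq_xy -leqNgt leqn0 cards_eq0.
by apply/eqP/setP=> i; rewrite !inE eqxx.
Qed.

Definition exact_dist_chi (F : finFieldType) (n d : nat) (d_gt0 : (0 < d)%N) :
    nat :=
  ex_minn (exact_dist_colorable_ex F n d_gt0).

(* Main.v *)
Require Import Defs.
From mathcomp Require Import all_boot all_order all_algebra.

(** Vectors at pairwise distance [d] need distinct colors. Two such families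
    give the two bounds: the [q] multiples of the indicator vector of [d]
    coordinates, and the indicator vectors of [n %/ d./2] disjoint blocks of
    [d./2] coordinates each. *)

Lemma leq_exact_dist_chi (F : finFieldType) (n d : nat) (d_gt0 : 0 < d)
    (I : finType) (f : I -> 'rV[F]_n) :
    (forall a b, a != b -> hamming_dist (f a) (f b) = d) ->
  #|I| <= exact_dist_chi F n d_gt0.
Proof.
move=> distf; rewrite /exact_dist_chi; case: ex_minnP => L /existsP[G colG] _.
(* A valid coloring [G] is injective along [f], so [G \o f] embeds [I] into the [L] colors. *)
rewrite -[L in _ <= L]card_ord; apply: (@leq_card _ _ (G \o f)) => a b /= eqG.
apply: contra_eq eqG => /distf dist_ab.
by have /forallP/(_ (f a))/forallP/(_ (f b)) := colG; rewrite dist_ab eqxx.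
Qed.

Lemma card_ord_interval (n s l : nat) :
  s + l <= n -> #|[set i : 'I_n | s <= i < s + l]| = l.
Proof.
(* Translation by [s] maps ['I_l] bijectively onto the interval. *)
move=> le_n; pose g (j : 'I_l) := widen_ord le_n (rshift s j).
have g_inj : injective g.
  by move=> i j /(congr1 val)/= /addnI/val_inj.
rewrite -[RHS]card_ord -(card_imset _ g_inj); apply: eq_card => i.
rewrite inE; apply/idP/imsetP => [/andP[le_si lt_i] | [j _ ->]].
  have lt_l : i - s < l by rewrite ltn_subLR.
  by exists (Ordinal lt_l) => //; apply: val_inj; rewrite /= subnKC.
by rewrite /= leq_addr ltn_add2l ltn_ord.
Qed.

(** The block is the interval from [a * e] to [a * e + e], upper end excluded; [a < n %/ e] makes it
    fit below [n], which leaves out an incomplete last block. *)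
Lemma card_ord_block (n e a : nat) :
  0 < e -> a < n %/ e -> #|[set i : 'I_n | i %/ e == a]| = e.
Proof.
move=> e_gt0 lt_a; rewrite -[RHS](@card_ord_interval n (a * e)); last first.
  by rewrite addnC -mulSn -leq_divRL.
apply: eq_card => i; rewrite !inE eqn_leq leq_divRL // andbC.
by rewrite -(ltnS (i %/ e)) ltn_divLR // mulSn addnC.
Qed.

Lemma hamming_dist_scaled_indicator (F : finFieldType) (n : nat)
    (A : {set 'I_n}) (a b : F) :
  a != b ->
  hamming_dist (\row_i (a *+ (i \in A)))%R (\row_i (b *+ (i \in A)))%R = #|A|.
Proof.
move=> neq_ab; apply: eq_card => i; rewrite inE !mxE.
by case: (i \in A); rewrite ?eqxx.
Qed.

(** Since 1 differs from 0 in [F], the vectors differ exactly on the union of [A] and [B]. *)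
Lemma hamming_dist_indicator (F : finFieldType) (n : nat) (A B : {set 'I_n}) :
  [disjoint A & B] ->
  hamming_dist (\row_i (i \in A)%:R : 'rV[F]_n)%R (\row_i (i \in B)%:R)%R
    = #|A| + #|B|.
Proof.
move=> disAB; rewrite -cardsUI (disjoint_setI0 disAB) cards0 addn0.
apply: eq_card => i; rewrite !inE !mxE.
have [iA | _] := boolP (i \in A); last first.
  by case: (i \in B); rewrite ?eqxx // eq_sym GRing.oner_eq0.
by rewrite (disjointFr disAB iA) GRing.oner_eq0.
Qed.

Theorem theorem3p2 (p k q : nat) (p_prime : prime p) (k_gt0 : 0 < k)
    (q_def : q = p ^ k) (F : finFieldType) (cardF : #|F| = q)
    (n d : nat) (d_even : ~~ odd d) (d_ge2 : 2 <= d) (d_le_n : d <= n) :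
  maxn q ((2 * n) %/ d) <= exact_dist_chi F n (ltnW d_ge2).
Proof.
rewrite geq_max -cardF; apply/andP; split.
  (* Any [d] coordinates would do; the first [d] exist because [d <= n]. *)
  pose A := [set i : 'I_n | 0 <= i < 0 + d].
  apply: (@leq_exact_dist_chi _ _ _ _ _ (fun a => \row_i (a *+ (i \in A)))%R).
  by move=> a b /hamming_dist_scaled_indicator->; apply: card_ord_interval.
(* Evenness of [d] turns [(2 * n) %/ d] into [n %/ d./2], the number of full blocks of length
   [d./2]. *)
have d_half : d = 2 * d./2 by rewrite mul2n even_halfK.
have e_gt0 : 0 < d./2 by rewrite half_gt0.
rewrite {1}d_half divnMl // -[n %/ _]card_ord.
pose B (a : 'I_(n %/ d./2)) := [set i : 'I_n | i %/ d./2 == a].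
apply: (@leq_exact_dist_chi _ _ _ _ _ (fun a => \row_i (i \in B a)%:R)%R).
move=> a b neq_ab; rewrite hamming_dist_indicator.
  by rewrite !card_ord_block // addnn even_halfK.
(* A coordinate common to both blocks would have quotient by [d./2] equal to both [a] and [b]. *)
rewrite -setI_eq0; apply/eqP/setP => i; rewrite !inE.
by apply: contraNF neq_ab => /andP[/eqP ia ib]; rewrite -val_eqE /= -ia.
Qed.
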